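(* Let $G$ be an Artin-Tits group of spherical type, and let $\alpha\in G$. Then: (1) $CRS(\alpha)=CRS(\alpha^m)$ for every $m\in\mathbb{Z}\setminus\{0\}$. (2) $CRS(\beta^{-1}\alpha\beta)=CRS(\alpha)^{\beta}$ for every $\beta\in G$. (3) $CRS(z\alpha)=CRS(\alpha)$ for every $z\in Z(G)$, the center of $G$.
   Context: An Artin-Tits group of spherical type $G$ is given by a finite set $\Sigma$ of standard generators and, for each pair of distinct $s,t\in\Sigma$, a relation $sts\cdots=tst\cdots$ with $m_{s,t}$ letters on each side ($2\le m_{s,t}<\infty$), such that the associated Coxeter group (add the relations $s^2=1$) is finite. Its Dynkin diagram is the graph with vertex set $\Sigma$ where $s,t$ are joined when $m_{s,t}\ge 3$. A positive element is a product of standard generators (possibly empty). Conjugation is $g^{h}=h^{-1}gh$, $P^{h}=h^{-1}Ph$; for a set $M$ of subgroups, $M^h=\{P^h : P\in M\}$. A standard parabolic subgroup is a subgroup generated by a subset of $\Sigma$; it is irreducible if the full subgraph of the Dynkin diagram spanned by these generators is connected. An (irreducible) parabolic subgroup is a conjugate of an (irreducible) standard parabolic subgroup; it is proper if it is neither trivial nor $G$. A (nontrivial) irreducible parabolic subgroup $P$ has infinite cyclic center, and $z_P$ denotes its unique generator which is conjugate to a positive element. Two irreducible parabolic subgroups $P,Q$ are adjacent if $z_Pz_Q=z_Qz_P$. The complex of irreducible parabolic subgroups $\mathcal{C}(G)$ is the simplicial complex whose simplices are the finite sets of pairwise adjacent proper irreducible parabolic subgroups (the empty set is a simplex of dimension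 $-1$). $G$ acts on $\mathcal{C}(G)$ by conjugation; the orbit of $P$ under $\alpha$ is $\{P^{\alpha^i}: i\in\mathbb{Z}\}$. A reduction simplex of $\alpha$ is a simplex $M$ of $\mathcal{C}(G)$ with $M^\alpha=M$; a reduction subgroup of $\alpha$ is a vertex of a reduction simplex of $\alpha$ (equivalently, a proper irreducible parabolic subgroup whose orbit under $\alpha$ is a simplex). A reduction subgroup of $\alpha$ is essential if it is adjacent to every proper irreducible parabolic subgroup whose orbit under $\alpha$ is finite. The canonical reduction system $CRS(\alpha)$ is the set of essential reduction subgroups of $\alpha$. *)

(* Defs.v *)
(* MathComp / MathComp-classical world: an infinite group is a [groupType],
   a subgroup of [G] is a [set G], and a set of subgroups a [set (set G)]. *)
From HB Require Import structures.
From mathcomp Require Import all_boot fingroup ssralg ssrint.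
From mathcomp Require Import boolp classical_sets functions cardinality.

Set Implicit Arguments.
Unset Strict Implicit.
Unset Printing Implicit Defensive.

Local Open Scope classical_set_scope.
Local Open Scope group_scope.

Section Groups.
Variable G : groupType.
Implicit Types (x g : G) (H P : set G) (M : set (set G)).

Definition expgz x (k : int) : G :=
  match k with Posz n => x ^+ n | Negz n => x ^- n.+1 end.

Definition subgroup_gen (A : set G) : set G :=
  smallest (fun H : set G => group_closed (mem H)) A.

Definition centre H : set G := [set x | H x /\ forall y, H y -> commute x y].

(* [x ^ g] is [g^-1 * (x * g)]. *)
Definition conj_set P g : set G := (fun x => x ^ g) @` P.

Definition conj_family M g : set (set G) := (fun P => conj_set P g) @` M.

Definition orbit_pow P x : set (set G) :=
  (fun k : int => conj_set P (expgz x k)) @` [set: int].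

End Groups.

Section Presentation.
Variable S : Type.

(* Group words over [S]: the letter [(s, false)] stands for [s] and
   [(s, true)] for its inverse. *)
Definition word := seq (S * bool).

(* The congruence on words whose quotient is the group < S | R >. *)
Inductive pres_eq (R : word -> word -> Prop) : word -> word -> Prop :=
| pres_refl u : pres_eq R u u
| pres_sym u v : pres_eq R u v -> pres_eq R v u
| pres_trans u v w : pres_eq R u v -> pres_eq R v w -> pres_eq R u w
| pres_cat u1 u2 v1 v2 :
    pres_eq R u1 v1 -> pres_eq R u2 v2 -> pres_eq R (u1 ++ u2) (v1 ++ v2)
| pres_cancel s b : pres_eq R [:: (s, b); (s, ~~ b)] [::]
| pres_rel u v : R u v -> pres_eq R u v.

Definition eval_word (G : groupType) (sigma : S -> G) (w : word) : G :=
  \prod_(l <- w) (if l.2 then (sigma l.1)^-1 else sigma l.1).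

(* [sigma] identifies [G] with < S | R >. *)
Definition presents (G : groupType) (sigma : S -> G)
    (R : word -> word -> Prop) : Prop :=
  (forall g : G, exists w : word, eval_word sigma w = g) /\
  (forall u v : word, eval_word sigma u = eval_word sigma v <-> pres_eq R u v).

End Presentation.

Section ArtinTits.
Variables (S : finType) (m : S -> S -> nat).

(* The diagonal of [m] is never used. *)
Definition coxeter_matrix : Prop :=
  (forall s t, m s t = m t s) /\ (forall s t, s != t -> 2 <= m s t).

Definition alternating (s t : S) (n : nat) : word S :=
  mkseq (fun i => (if odd i then t else s, false)) n.

Definition braid_relation (u v : word S) : Prop :=
  exists s t : S, [/\ s != t, u = alternating s t (m s t)
                    & v = alternating t s (m s t)].

Definition coxeter_relation (u v : word S) : Prop :=
  braid_relation u v \/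
  exists s : S, u = [:: (s, false); (s, false)] /\ v = [::].

(* [G], with standard generators [sigma s], is the Artin-Tits group of [m],
   and the Coxeter group of [m] is finite. *)
Definition spherical_artin_tits (G : groupType) (sigma : S -> G) : Prop :=
  [/\ coxeter_matrix, presents sigma braid_relation &
      exists (W : finGroupType) (r : S -> W), presents r coxeter_relation].

Definition dynkin_edge : rel S := [rel s t | (s != t) && (3 <= m s t)].

Definition dynkin_connected (X : {set S}) : Prop :=
  {in X &, forall s t : S,
    connect [rel a b | [&& a \in X, b \in X & dynkin_edge a b]] s t}.

Variables (G : groupType) (sigma : S -> G).
Implicit Types (x z alpha : G) (P Q : set G) (M : set (set G)).

Definition positive x : Prop := exists w : seq S, x = \prod_(s <- w) sigma s.

Definition standard_parabolic (X : {set S}) : set G :=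
  subgroup_gen [set sigma s | s in [set` X]].

Definition irreducible_parabolic P : Prop :=
  exists (X : {set S}) (g : G),
    dynkin_connected X /\ P = conj_set (standard_parabolic X) g.

Definition nontrivial_proper P : Prop := P <> [set 1] /\ P <> [set: G].

Definition proper_irreducible_parabolic P : Prop :=
  irreducible_parabolic P /\ nontrivial_proper P.

Definition is_central_generator P z : Prop :=
  centre P = subgroup_gen [set z] /\ exists g, positive (z ^ g).

(* The element z_P.  When [P] is a nontrivial irreducible parabolic subgroup,
   exactly one element satisfies the predicate, and the default value 1 plays
   no role. *)
Definition central_generator P : G := xget 1 (is_central_generator P).

Definition adjacent P Q : Prop :=
  central_generator P * central_generator Q =
  central_generator Q * central_generator P.

Definition simplex M : Prop :=
  [/\ finite_set M,
      forall P, M P -> proper_irreducible_parabolic P &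
      forall P Q, M P -> M Q -> adjacent P Q].

Definition reduction_simplex alpha M : Prop :=
  simplex M /\ conj_family M alpha = M.

Definition reduction_subgroup alpha P : Prop :=
  exists M, reduction_simplex alpha M /\ M P.

Definition essential alpha P : Prop :=
  reduction_subgroup alpha P /\
  forall Q, proper_irreducible_parabolic Q ->
    finite_set (orbit_pow Q alpha) -> adjacent P Q.

Definition CRS alpha : set (set G) := [set P | essential alpha P].

End ArtinTits.

(* Main.v *)
Require Import Defs.
From HB Require Import structures.
From mathcomp Require Import all_boot fingroup ssralg ssrint intdiv.
From mathcomp Require Import boolp classical_sets functions cardinality.

(* Conjugation transports simplices, orbits and adjacency.  A reduction simplex
   of [alpha] is one of all its powers; conversely an essential reduction
   subgroup of [alpha^k] has a finite orbit under [alpha], and is adjacent to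
   all of that orbit, which is therefore a simplex.  The one point that is not
   formal is that adjacency is invariant under conjugation: this requires the
   positive generator of the centre of [P] to be unique.  Braid relations are
   homogeneous, so there is a length morphism [G -> Z] which is nonnegative on
   conjugates of positive elements and vanishes there only at [1]; two
   generators of one cyclic group that are conjugate to positive elements then
   have equal length, and hence coincide. *)

Set Implicit Arguments.
Unset Strict Implicit.
Unset Printing Implicit Defensive.

Local Open Scope classical_set_scope.
Local Open Scope group_scope.

Section IntegerPowers.
Variable G : groupType.
Implicit Types (x g z : G) (i j k : int).

Lemma expgzN_nat x (n : nat) : expgz x (- n%:Z)%R = x ^- n.
Proof. by case: n => [|n] //=; rewrite !expg0 invg1. Qed.

Lemma expgz_succ x i : expgz x (i + 1)%R = expgz x i * x.
Proof.
case: i => n /=; first by rewrite addn1 expgSr.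
have -> : (Negz n + 1)%R = (- n%:Z)%R.
  by rewrite NegzE -addn1 PoszD GRing.opprD GRing.subrK.
by rewrite expgzN_nat expgS invgM mulgVK.
Qed.

Lemma expgz_pred x i : expgz x (i - 1)%R = expgz x i * x^-1.
Proof. by apply: (canRL (mulgK x)); rewrite -expgz_succ GRing.subrK. Qed.

Lemma int_succ_pred_ind (P : int -> Prop) :
  P 0%R -> (forall i, P i -> P (i + 1)%R) -> (forall i, P i -> P (i - 1)%R) ->
  forall i, P i.
Proof.
move=> P0 PS PN; elim/int_rect => // n IH.
  by rewrite -addn1 PoszD; apply: PS.
by rewrite -addn1 PoszD GRing.opprD; apply: PN.
Qed.

Lemma expgzD x i j : expgz x (i + j)%R = expgz x i * expgz x j.
Proof.
elim/int_succ_pred_ind: j => [|j IH|j IH].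
- by rewrite GRing.addr0 /= expg0 mulg1.
- by rewrite GRing.addrA !expgz_succ IH mulgA.
- by rewrite GRing.addrA !expgz_pred IH mulgA.
Qed.

Lemma expgzN x i : expgz x (- i)%R = (expgz x i)^-1.
Proof. by apply: (mulgI (expgz x i)); rewrite mulgV -expgzD GRing.subrr. Qed.

Lemma expgzM x i j : expgz x (i * j)%R = expgz (expgz x i) j.
Proof.
elim/int_succ_pred_ind: j => [|j IH|j IH].
- by rewrite GRing.mulr0.
- by rewrite GRing.mulrDr GRing.mulr1 expgz_succ -IH expgzD.
- by rewrite GRing.mulrBr GRing.mulr1 expgz_pred -IH expgzD expgzN.
Qed.

Lemma conj_expgz x g k : expgz x k ^ g = expgz (x ^ g) k.
Proof. by case: k => n /=; rewrite ?conjVg conjXg. Qed.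

Lemma subgroup_gen1 z : subgroup_gen [set z] = range (expgz z).
Proof.
apply/seteqP; split.
  apply: smallest_sub.
    split; first by apply/mem_set; exists 0%R.
    move=> _ _ /set_mem [i _ <-] /set_mem [j _ <-]; apply/mem_set.
    by exists (i - j)%R => //; rewrite expgzD expgzN.
  by move=> _ ->; exists 1%R.
move=> _ [k _ <-] H [cH zH].
have {}zH : z \in mem H by apply/mem_set/zH.
suff : expgz z k \in mem H by move/set_mem.
elim/int_succ_pred_ind: k => [|k IH|k IH]; first exact: cH.1.
- by rewrite expgz_succ; apply: (group_closedM cH).
- by rewrite expgz_pred; apply: cH.2.
Qed.

End IntegerPowers.

Section Conjugation.
Variable G : groupType.
Implicit Types (x y g h z : G) (P Q : set G) (M : set (set G)) (k : int).

Lemma conj_set1 P : conj_set P 1 = P.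
Proof.
by rewrite /conj_set (eq_imagel (f' := id)) ?image_id // => x _; rewrite conjg1.
Qed.

Lemma conj_setM P g h : conj_set P (g * h) = conj_set (conj_set P g) h.
Proof.
by rewrite /conj_set image_comp; apply: eq_imagel => x _; rewrite /= conjgM.
Qed.

Lemma conj_setK P g : conj_set (conj_set P g) g^-1 = P.
Proof. by rewrite -conj_setM mulgV conj_set1. Qed.

Lemma conj_setKV P g : conj_set (conj_set P g^-1) g = P.
Proof. by rewrite -conj_setM mulVg conj_set1. Qed.

Lemma conj_familyM M g h :
  conj_family M (g * h) = conj_family (conj_family M g) h.
Proof.
rewrite /conj_family image_comp; apply: eq_imagel => P _.
by rewrite /= conj_setM.
Qed.

Lemma conj_family1 M : conj_family M 1 = M.
Proof.
rewrite /conj_family (eq_imagel (f' := id)) ?image_id // => P _.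
by rewrite conj_set1.
Qed.

Lemma conj_set_set1 x g : conj_set [set x] g = [set x ^ g].
Proof. exact: image_set1. Qed.

Lemma conj_setT g : conj_set [set: G] g = [set: G].
Proof. by apply/seteqP; split=> // x _; exists (x ^ g^-1); rewrite ?conjgKV. Qed.

Lemma conj_family_expgz M x k :
  conj_family M x = M -> conj_family M (expgz x k) = M.
Proof.
move=> Mx; elim/int_succ_pred_ind: k => [|k IH|k IH].
- by rewrite /= expg0 conj_family1.
- by rewrite expgz_succ conj_familyM IH.
- by rewrite expgz_pred conj_familyM IH -{1}Mx -conj_familyM mulgV conj_family1.
Qed.

Lemma sub_centre_conj P g : conj_set (centre P) g `<=` centre (conj_set P g).
Proof.
move=> _ [x [Px cPx] <-]; split; first by exists x.
by move=> _ [y Py <-]; rewrite /commute -!conjMg cPx.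
Qed.

Lemma centre_conj P g : centre (conj_set P g) = conj_set (centre P) g.
Proof.
apply/seteqP; split; last exact: sub_centre_conj.
move=> x cx; exists (x ^ g^-1); last exact: conjgKV.
by rewrite -(conj_setK P g); apply: sub_centre_conj; exists x.
Qed.

Lemma subgroup_gen1_conj z g :
  subgroup_gen [set z ^ g] = conj_set (subgroup_gen [set z]) g.
Proof.
rewrite !subgroup_gen1 /conj_set image_comp.
by apply: eq_imagel => k _; rewrite /= conj_expgz.
Qed.

Lemma orbit_pow_refl P x : orbit_pow P x P.
Proof. by exists 0%R; rewrite //= expg0 conj_set1. Qed.

Lemma orbit_pow_conj P x g :
  orbit_pow (conj_set P g) (x ^ g) = conj_family (orbit_pow P x) g.
Proof.
rewrite /orbit_pow /conj_family image_comp; apply: eq_imagel => k _ /=.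
by rewrite -conj_expgz -!conj_setM conjgE mulgA mulgV mul1g.
Qed.

Lemma conj_family_orbit_pow P x : conj_family (orbit_pow P x) x = orbit_pow P x.
Proof.
apply/seteqP; split=> [_ [_ [k _ <-] <-]|_ [k _ <-]].
  by exists (k + 1)%R; rewrite // expgz_succ conj_setM.
exists (conj_set P (expgz x (k - 1)%R)); first by exists (k - 1)%R.
by rewrite -conj_setM -expgz_succ GRing.subrK.
Qed.

Lemma orbit_pow_sub P Q x : orbit_pow P x Q -> orbit_pow Q x `<=` orbit_pow P x.
Proof.
move=> [i _ <-] _ [j _ <-]; exists (i + j)%R => //.
by rewrite expgzD conj_setM.
Qed.

Lemma orbit_pow_expgz_sub P x k : orbit_pow P (expgz x k) `<=` orbit_pow P x.
Proof. by move=> _ [j _ <-]; exists (k * j)%R; rewrite // expgzM. Qed.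

Lemma finite_orbit_expgz P x k : k <> 0%R ->
  finite_set (orbit_pow P (expgz x k)) <-> finite_set (orbit_pow P x).
Proof.
move=> /eqP k0; split=> [fin|]; last exact/sub_finite_set/orbit_pow_expgz_sub.
apply: (@sub_finite_set _ _ (\bigcup_(r in `I_`|k|%N)
    conj_family (orbit_pow P (expgz x k)) (x ^+ r))); last first.
  by apply: bigcup_finite => [|r _]; [exact: finite_II|exact: finite_image].
move=> _ [i _ <-]; exists `|(i %% k)%Z|%N => /=.
  by rewrite -ltz_nat gez0_abs ?modz_ge0 // ltz_mod.
exists (conj_set P (expgz (expgz x k) (i %/ k)%Z)); first by exists (i %/ k)%Z.
rewrite -conj_setM -expgzM -[x ^+ _]/(expgz x `|(i %% k)%Z|%N%:Z).
by rewrite gez0_abs ?modz_ge0 // -expgzD GRing.mulrC -divz_eq.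
Qed.

Lemma conj_set_ext P x y : (forall g, g ^ x = g ^ y) -> conj_set P x = conj_set P y.
Proof. by move=> xy; apply: eq_imagel => g _; rewrite xy. Qed.

Lemma conj_expgz_ext x y k :
  (forall g, g ^ x = g ^ y) -> forall g, g ^ expgz x k = g ^ expgz y k.
Proof.
move=> xy g; elim/int_succ_pred_ind: k => [//|k IH|k IH].
- by rewrite !expgz_succ !conjgM IH xy.
- rewrite !expgz_pred !conjgM IH.
  by apply: (can_inj (conjgK x)); rewrite conjgKV xy conjgKV.
Qed.

Lemma orbit_pow_ext P x y :
  (forall g, g ^ x = g ^ y) -> orbit_pow P x = orbit_pow P y.
Proof.
by move=> xy; apply: eq_imagel => k _; apply/conj_set_ext/conj_expgz_ext.
Qed.

End Conjugation.

Section WordLength.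
Variables (S : finType) (m : S -> S -> nat).

Definition word_length (w : word S) : int :=
  (\sum_(l <- w) if l.2 then -1 else 1)%R.

Lemma word_length_positive (w : word S) :
  all (fun l => ~~ l.2) w -> word_length w = size w.
Proof.
rewrite /word_length; elim: w => [|[s b] w IH] /=; first by rewrite big_nil.
by case: b => //= /IH; rewrite big_cons => ->.
Qed.

Lemma word_length_alternating s t n : word_length (alternating s t n) = n.
Proof.
rewrite word_length_positive ?size_mkseq //.
by apply/allP => _ /mapP [i _ ->].
Qed.

Lemma word_length_pres_eq u v : (forall s t, m s t = m t s) ->
  pres_eq (braid_relation m) u v -> word_length u = word_length v.
Proof.
move=> msym; elim=> {u v} //.
- by move=> u v w _ -> _ ->.
- move=> u1 u2 v1 v2 _ IHu _ IHv.
  by rewrite /word_length !big_cat /= -!/(word_length _) IHu IHv.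
- by move=> s b; rewrite /word_length !big_cons !big_nil; case: b.
- by move=> _ _ [s [t [_ -> ->]]]; rewrite !word_length_alternating.
Qed.

End WordLength.

Section LengthMorphism.
Variables (G : groupType) (len : G -> int).
Hypothesis lenM : forall x y, len (x * y) = (len x + len y)%R.

Lemma len1 : len 1 = 0%R.
Proof. by apply: (GRing.addrI (len 1)); rewrite -lenM mulg1 GRing.addr0. Qed.

Lemma lenV x : len x^-1 = (- len x)%R.
Proof. by apply: (GRing.addrI (len x)); rewrite -lenM mulgV len1 GRing.subrr. Qed.

Lemma lenJ x g : len (x ^ g) = len x.
Proof. by rewrite conjgE !lenM lenV GRing.addrCA GRing.addNr GRing.addr0. Qed.

Lemma len_expgz x k : len (expgz x k) = (k * len x)%R.
Proof.
elim/int_succ_pred_ind: k => [|k IH|k IH].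
- by rewrite GRing.mul0r /= expg0 len1.
- by rewrite expgz_succ lenM IH GRing.mulrDl GRing.mul1r.
- by rewrite expgz_pred lenM lenV IH GRing.mulrBl GRing.mul1r.
Qed.

End LengthMorphism.

Section ArtinTitsTheory.
Variables (S : finType) (m : S -> S -> nat) (G : groupType) (sigma : S -> G).
Hypothesis hG : spherical_artin_tits m sigma.
Implicit Types (x y g h z alpha beta : G) (P Q : set G) (M : set (set G)).

Lemma exists_length : exists len : G -> int,
  (forall x y, len (x * y) = (len x + len y)%R) /\
  forall w : seq S, len (\prod_(s <- w) sigma s) = size w.
Proof.
have [[msym _] [surj evalP] _] := hG.
have [r rK] := choice surj.
have lenE u : word_length (r (eval_word sigma u)) = word_length u.
  by apply: (word_length_pres_eq msym); apply/evalP; rewrite rK.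
exists (fun x => word_length (r x)); split=> [x y|w].
  rewrite -{1}(rK x) -{1}(rK y) /eval_word -big_cat lenE.
  by rewrite /word_length big_cat.
have -> : \prod_(s <- w) sigma s = eval_word sigma [seq (s, false) | s <- w].
  by rewrite /eval_word big_map.
rewrite lenE word_length_positive ?size_map //.
by apply/allP => _ /mapP [s _ ->].
Qed.

Lemma central_generator_unique P z z' :
  is_central_generator sigma P z -> is_central_generator sigma P z' -> z = z'.
Proof.
have [len [lenM lenP]] := exists_length.
have nneg y g : positive sigma (y ^ g) ->
    exists n : nat, len y = n /\ (n = 0 -> y = 1).
  move=> [w yw]; exists (size w); rewrite -(lenJ lenM y g) yw lenP; split=> //.
  move=> /size0nil w0; apply: (can_inj (conjgK g)).
  by rewrite yw w0 big_nil conj1g.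
move=> [cz [g /nneg [n [zn z1]]]] [cz' [g' /nneg [n' [zn' z1']]]].
have zz' : range (expgz z) = range (expgz z').
  by rewrite -!subgroup_gen1 -cz -cz'.
have [a _ az] : range (expgz z) z' by rewrite zz'; exists 1%R.
have [b _ bz] : range (expgz z') z by rewrite -zz'; exists 1%R.
have an : (n'%:Z = a * n)%R by rewrite -zn' -az (len_expgz lenM) zn.
have bn : (n%:Z = b * n')%R by rewrite -zn -bz (len_expgz lenM) zn'.
have nn' : n = n'.
  apply/eqP; rewrite eqn_dvd; apply/andP; split.
    by rewrite -(absz_nat n') an abszM dvdn_mull.
  by rewrite -(absz_nat n) bn abszM dvdn_mull.
have [n0|n0] := eqVneq n 0; first by rewrite z1 // z1' // -nn'.
have a1 : a = 1%R.
  apply: (@GRing.mulIf _ (Posz n)); first by rewrite eqz_nat.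
  by rewrite -an nn' GRing.mul1r.
by rewrite -az a1.
Qed.

Lemma is_central_generator_conj P z g :
  is_central_generator sigma P z ->
  is_central_generator sigma (conj_set P g) (z ^ g).
Proof.
move=> [cz [h hpos]]; split; first by rewrite centre_conj cz subgroup_gen1_conj.
by exists (g^-1 * h); rewrite conjgM conjgK.
Qed.

Lemma central_generator_conj P g :
  central_generator sigma (conj_set P g) = central_generator sigma P ^ g.
Proof.
rewrite /central_generator.
have [[z Pz]|noz] := pselect (exists z, is_central_generator sigma P z).
  have Pgz := is_central_generator_conj g Pz.
  rewrite (xget_unique _ Pz); last by move=> y /central_generator_unique; apply.
  by apply: xget_unique => // y /central_generator_unique; apply.
rewrite !xgetPN ?conj1g // => z Pz; apply: noz; first by exists z.
by exists (z ^ g^-1); rewrite -(conj_setK P g); apply: is_central_generator_conj.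
Qed.

Lemma adjacent_conj P Q g :
  adjacent sigma P Q -> adjacent sigma (conj_set P g) (conj_set Q g).
Proof. by rewrite /adjacent !central_generator_conj -!conjMg => ->. Qed.

Lemma proper_irreducible_conj P g :
  proper_irreducible_parabolic m sigma P ->
  proper_irreducible_parabolic m sigma (conj_set P g).
Proof.
move=> [[X [h [cX PX]]] [P1 PT]]; split.
  by exists X, (h * g); rewrite conj_setM -PX.
split=> Pg; [apply: P1|apply: PT]; rewrite -(conj_setK P g) Pg.
  by rewrite conj_set_set1 conj1g.
exact: conj_setT.
Qed.

Lemma simplex_conj M g : simplex m sigma M -> simplex m sigma (conj_family M g).
Proof.
move=> [fM pM aM]; split; first exact: finite_image.
  by move=> _ [P MP <-]; apply/proper_irreducible_conj/pM.
by move=> _ _ [P MP <-] [Q MQ <-]; apply/adjacent_conj/aM.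
Qed.

Lemma reduction_subgroup_proper alpha P :
  reduction_subgroup m sigma alpha P -> proper_irreducible_parabolic m sigma P.
Proof. by move=> [M [[[_ pM _] _] /pM]]. Qed.

Lemma reduction_subgroup_finite_orbit alpha P :
  reduction_subgroup m sigma alpha P -> finite_set (orbit_pow P alpha).
Proof.
move=> [M [[[fM _ _] Ma] MP]]; apply: sub_finite_set fM => _ [k _ <-].
by rewrite -(conj_family_expgz k Ma); exists P.
Qed.

Lemma essential_conj alpha beta P :
  essential m sigma alpha P ->
  essential m sigma (alpha ^ beta) (conj_set P beta).
Proof.
move=> [[M [[sM Ma] MP]] adjP]; split.
  exists (conj_family M beta); split; last by exists P.
  split; first exact: simplex_conj.
  by rewrite -conj_familyM conjgE mulgA mulgV mul1g conj_familyM Ma.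
move=> Q pQ fQ; rewrite -(conj_setKV Q beta); apply/adjacent_conj/adjP.
  exact: proper_irreducible_conj.
by rewrite -[alpha](conjgK beta) orbit_pow_conj; apply: finite_image.
Qed.

Lemma reduction_subgroup_expgz alpha k P :
  reduction_subgroup m sigma alpha P ->
  reduction_subgroup m sigma (expgz alpha k) P.
Proof.
move=> [M [[sM Ma] MP]]; exists M; split=> //; split=> //.
exact: conj_family_expgz.
Qed.

Lemma essential_expgz alpha (k : int) P : k <> 0%R ->
  essential m sigma alpha P <-> essential m sigma (expgz alpha k) P.
Proof.
move=> k0; split=> [[redP adjP]|[redP adjP]]; split.
- exact: reduction_subgroup_expgz.
- by move=> Q pQ /(finite_orbit_expgz _ _ k0); apply: adjP.
- have pP := reduction_subgroup_proper redP.
  have fP : finite_set (orbit_pow P alpha).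
    by apply/(finite_orbit_expgz _ _ k0)/reduction_subgroup_finite_orbit.
  exists (orbit_pow P alpha); split; last exact: orbit_pow_refl.
  split; last exact: conj_family_orbit_pow.
  split=> // [_ [i _ <-]|_ _ [i _ <-] [j _ <-]].
    exact: proper_irreducible_conj.
  rewrite -(GRing.subrK i j) expgzD conj_setM; apply/adjacent_conj/adjP.
    exact: proper_irreducible_conj.
  apply/(finite_orbit_expgz _ _ k0)/(sub_finite_set _ fP)/orbit_pow_sub.
  by exists (j - i)%R.
- by move=> Q pQ /(finite_orbit_expgz _ _ k0); apply: adjP.
Qed.

Lemma essential_ext alpha beta P : (forall g, g ^ alpha = g ^ beta) ->
  essential m sigma alpha P -> essential m sigma beta P.
Proof.
move=> ab [[M [[sM Ma] MP]] adjP]; split.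
  exists M; split=> //; split=> //; rewrite -{2}Ma.
  by apply: eq_imagel => Q _; apply: conj_set_ext => g; rewrite ab.
by move=> Q pQ; rewrite -(orbit_pow_ext Q ab); apply: adjP.
Qed.

End ArtinTitsTheory.

Theorem proposition22 (S : finType) (m : S -> S -> nat) (G : groupType)
    (sigma : S -> G) (hG : spherical_artin_tits m sigma) (alpha : G) :
  [/\ forall k : int, k <> 0%R ->
        CRS m sigma alpha = CRS m sigma (expgz alpha k),
      forall beta : G,
        CRS m sigma (beta^-1 * alpha * beta) =
        conj_family (CRS m sigma alpha) beta &
      forall z : G, centre [set: G] z ->
        CRS m sigma (z * alpha) = CRS m sigma alpha].
Proof.
split=> [k k0|beta|z [_ cz]].
- by apply/seteqP; split=> P /(essential_expgz hG alpha P k0).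
- rewrite -mulgA -conjgE; apply/seteqP; split=> [P|_ [Q eQ <-]].
    move/(essential_conj hG beta^-1); rewrite conjgK => eP.
    by exists (conj_set P beta^-1); last exact: conj_setKV.
  exact: (essential_conj hG).
- have conj_z g : g ^ (z * alpha) = g ^ alpha.
    by rewrite conjgM [g ^ z]conjgE -cz // mulKg.
  by apply/seteqP; split=> P; apply: essential_ext.
Qed.
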